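(* For any graph $G$ with $n$ vertices, \[ \alpha_1(G) + \tau_1(G) \leq \alpha_1(G) + \tau_{\mathrm{B}}(G) \leq \frac{5n^2}{16}. \]
   Context: Graphs are finite and simple. For a graph $G$ with edge set $E(G)$, a set $A \subseteq E(G)$ is triangle-independent if it contains at most one edge from each triangle of $G$; $\alpha_1(G)$ denotes the maximum size of a triangle-independent set of edges in $G$. A set $X \subseteq E(G)$ is a triangle edge cover if $G \setminus X$ (the graph obtained by deleting the edges in $X$) is triangle-free; $\tau_1(G)$ denotes the minimum size of a triangle edge cover in $G$. $\tau_{\mathrm{B}}(G)$ denotes the smallest size of an edge set $X \subseteq E(G)$ such that $G \setminus X$ is bipartite. *)

(* Defs.v *)
From mathcomp Require Import all_boot.
Set Implicit Arguments.
Unset Strict Implicit.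
Unset Printing Implicit Defensive.

(* A finite simple graph on the vertex type T is a symmetric irreflexive
   relation e : rel T; an edge is the two-element set of its endpoints. *)
Section Graph.
Variables (T : finType) (e : rel T).

Definition edges : {set {set T}} := [set [set p.1; p.2] | p : T * T & e p.1 p.2].

Definition del_edges (X : {set {set T}}) : rel T :=
  [rel x y | e x y && ([set x; y] \notin X)].

(* The three vertices are distinct as soon as e is irreflexive. *)
Definition triangle (x y z : T) : bool := [&& e x y, e y z & e x z].

Definition triangle_edges (x y z : T) : {set {set T}} :=
  [set [set x; y]; [set y; z]; [set x; z]].

Definition triangle_free : bool :=
  [forall x, forall y, forall z, ~~ triangle x y z].

Definition bipartite : bool :=
  [exists S : {set T}, forall x, forall y,
    e x y ==> ((x \in S) != (y \in S))].

Definition triangle_independent (A : {set {set T}}) : bool :=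
  (A \subset edges) &&
  [forall x, forall y, forall z,
    triangle x y z ==> (#|A :&: triangle_edges x y z| <= 1)].

Definition alpha1 : nat :=
  \max_(A : {set {set T}} | triangle_independent A) #|A|.

End Graph.

Section Cover.
Variables (T : finType) (e : rel T).

Definition triangle_edge_cover (X : {set {set T}}) : bool :=
  (X \subset edges e) && triangle_free (del_edges e X).

Definition bipartite_edge_cover (X : {set {set T}}) : bool :=
  (X \subset edges e) && bipartite (del_edges e X).

Lemma del_all_edges x y : del_edges e (edges e) x y = false.
Proof.
by apply/andP => -[exy /negP[]]; apply/imsetP; exists (x, y); rewrite ?inE.
Qed.

Lemma triangle_edge_cover_edges : triangle_edge_cover (edges e).
Proof.
rewrite /triangle_edge_cover subxx; apply/forallP => x; apply/forallP => y.
by apply/forallP => z; rewrite /triangle del_all_edges.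
Qed.

Lemma bipartite_edge_cover_edges : bipartite_edge_cover (edges e).
Proof.
rewrite /bipartite_edge_cover subxx; apply/existsP; exists set0.
by apply/forallP => x; apply/forallP => y; rewrite del_all_edges.
Qed.

(* The two lemmas above show that the starting point edges e satisfies the
   predicates, so these arg min are genuine minimizers. *)
Definition tau1 : nat :=
  #|[arg min_(X < edges e | triangle_edge_cover X) #|X|]|.

Definition tauB : nat :=
  #|[arg min_(X < edges e | bipartite_edge_cover X) #|X|]|.

End Cover.

(* Main.v *)
(* Let A be triangle-independent, with degrees a_v, and let d_v be the degrees
   in G.  By induction on n, some cut misses t edges with |A| + t <= 5n^2/16.
   A deleted vertex v, or a deleted edge vw of A with v and w on opposite sides,
   can be put back so that at least half of the edges to the rest are cut.  So
   the induction hypothesis suffices unless, up to lower-order terms that the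
   two cases together absorb, 2a_v + d_v > 5n/4 for every v and
   a_v + a_w + (d_v + d_w)/2 > 5n/4 for every vw in A.
   As a_v + d_w <= n for vw in A (no A-neighbour of v is adjacent to another),
   this forces a_v >= n/4 and d_v <= 3n/4 for all v.  The cuts around the
   independent sets N_A(v) then miss on average |E| - (sum_v a_v d_v)/n edges,
   and (n/2 - a_v)(d_v - n/2) <= n^2/16 pointwise gives the bound. *)
Require Import Defs.
From mathcomp Require Import all_boot all_order all_algebra.
From mathcomp Require Import zify.
Import Order.TTheory GRing.Theory Num.Theory.
Local Open Scope ring_scope.

Set Implicit Arguments.
Unset Strict Implicit.
Unset Printing Implicit Defensive.

(** * Counting ordered adjacent pairs and the edges that a cut misses *)

Section PairCounts.
Local Open Scope nat_scope.
Variable T : finType.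
Implicit Types (f : rel T) (X Y V D : {set T}) (s : T -> bool).

Definition deg f X (x : T) : nat := \sum_(y in X) f x y.

(* Ordered pairs: an edge inside [X] contributes 2 to [pairs f X X]. *)
Definition pairs f X Y : nat := \sum_(x in X) deg f Y x.

(** The edges that the cut [s] misses; deleting them leaves a bipartite graph. *)
Definition mono f s : rel T := [rel x y | f x y && (s x == s y)].

Lemma mono_sym f s : symmetric f -> symmetric (mono f s).
Proof. by move=> f_sym x y; rewrite /mono /= f_sym (eq_sym (s x)). Qed.

Lemma deg_leq f g X x : subrel f g -> deg f X x <= deg g X x.
Proof.
move=> fg; apply: leq_sum => y _.
by case fxy: (f x y) => //; rewrite (fg _ _ fxy).
Qed.

Lemma degID f X D x : D \subset X -> deg f X x = deg f D x + deg f (X :\: D) x.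
Proof.
move=> DX; rewrite /deg (big_setID D) /=; congr (_ + _).
by move/setIidPr: DX => ->.
Qed.

Lemma pairsC f X Y : symmetric f -> pairs f X Y = pairs f Y X.
Proof.
move=> f_sym; rewrite /pairs /deg exchange_big /=.
by apply: eq_bigr => x _; apply: eq_bigr => y _; rewrite f_sym.
Qed.

Lemma pairsID f V D : symmetric f -> D \subset V ->
  pairs f V V
    = pairs f D D + 2 * pairs f D (V :\: D) + pairs f (V :\: D) (V :\: D).
Proof.
move=> f_sym DV; rewrite {1}/pairs (big_setID D) /=.
move/setIidPr: (DV) => ->; under eq_bigr do rewrite (degID _ _ DV).
under [X in _ + X]eq_bigr do rewrite (degID _ _ DV).
rewrite !big_split /= -!/(pairs _ _ _) (pairsC (V :\: D) D f_sym); lia.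
Qed.

Lemma deg_setU1 f X x y : y \notin X -> deg f (y |: X) x = f x y + deg f X x.
Proof. by move=> yX; rewrite /deg big_setU1. Qed.

Lemma deg_lt f V x : irreflexive f -> x \in V -> deg f V x < #|V|.
Proof.
move=> f_irr xV; rewrite /deg (bigD1 x) //= f_irr add0n.
rewrite (cardsD1 x) xV ltnS -sum1_card.
rewrite [leqRHS](eq_bigl (fun i => (i \in V) && (i != x))); last first.
  by move=> i; rewrite !inE andbC.
by apply: leq_sum => i _; case: (f x i).
Qed.

(* The two opposite ways of gluing [t] on [D] to [s] outside [D] together
   cut each edge between [D] and its complement exactly once. *)
Lemma mono_extend f V D s (t : T -> bool) : symmetric f -> D \subset V ->
  {in D &, forall x y, f x y -> t x != t y} ->
  exists s', pairs (mono f s') V V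
    <= pairs f D (V :\: D) + pairs (mono f s) (V :\: D) (V :\: D).
Proof.
move=> f_sym DV tP; pose c b x := if x \in D then b (+) t x else s x.
have split_c b : pairs (mono f (c b)) V V =
    2 * pairs (mono f (c b)) D (V :\: D)
    + pairs (mono f s) (V :\: D) (V :\: D).
  rewrite (pairsID (mono_sym _ f_sym) DV); congr (_ + _).
    rewrite [X in X + _]big1 // => x xD; rewrite /deg big1 // => y yD.
    rewrite /mono /= /c xD yD; case fxy: (f x y) => //=.
    by have := tP _ _ xD yD fxy; case: b; case: (t x); case: (t y).
  apply: eq_bigr => x /setDP[_ /negPf xD].
  apply: eq_bigr => y /setDP[_ /negPf yD].
  by rewrite /mono /= /c xD yD.
have cross : pairs (mono f (c true)) D (V :\: D)
    + pairs (mono f (c false)) D (V :\: D) = pairs f D (V :\: D).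
  rewrite /pairs -big_split; apply: eq_bigr => x xD.
  rewrite /deg -big_split; apply: eq_bigr => y /setDP[_ /negPf yD].
  by rewrite /mono /= /c xD yD; case: (f x y); case: (t x); case: (s y).
case: (leqP (pairs (mono f (c true)) D (V :\: D))
            (pairs (mono f (c false)) D (V :\: D))) => le_tf.
  by exists (c true); rewrite split_c; lia.
by exists (c false); rewrite split_c; lia.
Qed.

(** Each edge has at most one end in the independent set [s] and is cut when it has one, so the
    degree sum over [s] counts the cut edges. *)
Lemma mono_independent f V s : symmetric f ->
  (forall x y, s x -> s y -> ~~ f x y) ->
  pairs (mono f s) V V + 2 * (\sum_(x in V) s x * deg f V x) <= pairs f V V.
Proof.
move=> f_sym sP.
have E : \sum_(x in V) s x * deg f V x
    = \sum_(x in V) \sum_(y in V) s x * f x y.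
  by apply: eq_bigr => x _; rewrite big_distrr.
have E' : \sum_(x in V) s x * deg f V x
    = \sum_(x in V) \sum_(y in V) s y * f x y.
  rewrite E exchange_big; apply: eq_bigr => x _; apply: eq_bigr => y _.
  by rewrite f_sym.
rewrite mul2n -addnn {1}E E' /pairs /deg -!big_split; apply: leq_sum => x _.
rewrite -!big_split; apply: leq_sum => y _; rewrite /mono /=.
case fxy: (f x y) => /=; last by rewrite !muln0.
by have := @sP x y; rewrite fxy; case: (s x); case: (s y) => // /(_ isT isT).
Qed.

End PairCounts.

(** * Bounding the best cut by induction on the vertex set *)

Section CutBound.
Local Open Scope nat_scope.
Variables (T : finType) (e r : rel T).
Implicit Types (V : {set T}) (s : T -> bool).
Hypotheses (e_sym : symmetric e) (e_irr : irreflexive e).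
Hypotheses (r_sym : symmetric r) (re : subrel r e).
Hypothesis r_indep : forall x y z, r x y -> r x z -> ~~ e y z.

Lemma deg_add_leq V v w : r v w -> deg r V v + deg e V w <= #|V|.
Proof.
move=> rvw; rewrite /deg -big_split -sum1_card; apply: leq_sum => y _ /=.
have := @r_indep v w y rvw.
by case: (r v y); case: (e w y) => // /(_ isT).
Qed.

(** With [n = #|V|], restoring [v] raises the two counts by [2 a_v] and at most [d_v]; eight times
    this must fit into [5n^2 - 5(n-1)^2 = 10n - 5]. *)
Lemma cut_bound_vertex V v s : v \in V ->
  8 * (pairs r (V :\ v) (V :\ v) + pairs (mono e s) (V :\ v) (V :\ v))
    <= 5 * #|V :\ v| ^ 2 ->
  16 * deg r V v + 8 * deg e V v + 5 <= 10 * #|V| ->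
  exists s', 8 * (pairs r V V + pairs (mono e s') V V) <= 5 * #|V| ^ 2.
Proof.
move=> vV IH small; have vs : [set v] \subset V by rewrite sub1set.
have r_irr x : r x x = false by apply/negP => /re; rewrite e_irr.
have [|s' s'P] := @mono_extend _ e V [set v] s xpredT e_sym vs.
  by move=> x y /set1P-> /set1P->; rewrite e_irr.
exists s'; move: s'P; rewrite (pairsID r_sym vs).
have degD f : irreflexive f -> deg f V v = deg f (V :\ v) v.
  by move=> f_irr; rewrite -{1}(setD1K vV) deg_setU1 ?setD11 // f_irr.
rewrite /pairs !big_set1 -!/(pairs _ _ _) -(degD e) // -(degD r) //.
have -> : deg r [set v] v = 0 by rewrite /deg big_set1 r_irr.
move: IH small; rewrite (cardsD1 v V) vV; nia.
Qed.

(** As [vw] is a single edge and is cut, the counts grow by [2 (a_v + a_w) - 2] and at most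
    [d_v + d_w - 2]. The room is [5n^2 - 5(n-2)^2 = 20n - 20], whence the 12. *)
Lemma cut_bound_edge V v w s : v \in V -> w \in V -> r v w ->
  let V' := V :\: [set v; w] in
  8 * (pairs r V' V' + pairs (mono e s) V' V') <= 5 * #|V'| ^ 2 ->
  16 * (deg r V v + deg r V w) + 8 * (deg e V v + deg e V w)
    <= 20 * #|V| + 12 ->
  exists s', 8 * (pairs r V V + pairs (mono e s') V V) <= 5 * #|V| ^ 2.
Proof.
move=> vV wV rvw V' IH small.
have evw := re rvw.
have vw : v != w by apply/eqP => vw; rewrite vw e_irr in evw.
have vs : [set v; w] \subset V by rewrite subUset !sub1set vV.
have r_irr x : r x x = false by apply/negP => /re; rewrite e_irr.
have [|s' s'P] := @mono_extend _ e V [set v; w] s (pred1 v) e_sym vs.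
  move=> x y /set2P[]-> /set2P[]->; rewrite /= ?eqxx ?e_irr //.
    by rewrite (eq_sym w) (negPf vw).
  by rewrite (eq_sym w) (negPf vw).
exists s'; move: s'P; rewrite (pairsID r_sym vs).
have degv f : irreflexive f -> symmetric f -> f v w ->
    deg f V v = (deg f V' v).+1 /\ deg f V w = (deg f V' w).+1.
  move=> f_irr f_sym fvw; rewrite !(degID f _ vs) -/V' {1 4}/deg.
  by rewrite !big_setU1 ?inE //= !big_set1 !f_irr (f_sym w) fvw addn0.
have [ev ew] := degv e e_irr e_sym evw.
have [rv rw] := degv r r_irr r_sym rvw.
have cross f : pairs f [set v; w] V' = deg f V' v + deg f V' w.
  by rewrite /pairs big_setU1 ?inE //= big_set1.
have inner : pairs r [set v; w] [set v; w] = 2.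
  rewrite /pairs /deg !big_setU1 ?inE //= !big_set1 !big_setU1 ?inE //=.
  by rewrite !big_set1 !r_irr (r_sym w) rvw.
have cardV : #|V| = #|V'|.+2.
  have := subset_leq_card vs; rewrite /V' cardsD (setIidPr vs) cards2 vw; lia.
rewrite -/V' !cross inner; move: IH small; rewrite cardV ev ew rv rw; nia.
Qed.

(** This is [(n/2 - a)(d - n/2) <= n^2/16] cleared of denominators. If [a <= n/2], the first factor
    lies between 0 and [n/4] and the second is at most [n/4]; otherwise [a <= d] makes the product
    nonpositive. *)
Lemma quarter_degrees_bound n a d : n <= 4 * a -> a <= d -> 4 * d <= 3 * n ->
  8 * (n * d + n * a) <= 5 * n ^ 2 + 16 * (a * d).
Proof.
move=> na ad dn; case: (leqP (2 * a) n) => an.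
  (* This is [4 * d <= 3 * n] multiplied by the nonnegative [n - 2 * a]. *)
  have h1 : 4 * (n * d) + 6 * (n * a) <= 3 * n ^ 2 + 8 * (a * d).
    have [k nE] : exists k, n = 2 * a + k by exists (n - 2 * a); lia.
    by subst n; nia.
  by nia.
have [k aE] : exists k, 2 * a = n + k by exists (2 * a - n); lia.
have [l dE] : exists l, 2 * d = n + l by exists (2 * d - n); lia.
by nia.
Qed.

Lemma cut_bound_average V : 0 < #|V| ->
  {in V, forall v, #|V| <= 4 * deg r V v} ->
  {in V, forall v, 4 * deg e V v <= 3 * #|V|} ->
  exists s, 8 * (pairs r V V + pairs (mono e s) V V) <= 5 * #|V| ^ 2.
Proof.
move=> V0 aP dP; set n := #|V|.
case: (boolP [exists v in V,
  8 * (pairs r V V + pairs (mono e (r v)) V V) <= 5 * n ^ 2]).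
  by case/exists_inP => v _ le; exists (r v).
rewrite negb_exists_in => /forall_inP all_bad; exfalso.
have cut v : pairs (mono e (r v)) V V
    + 2 * (\sum_(x in V) r v x * deg e V x) <= pairs e V V.
  by apply: mono_independent => // x y; apply: r_indep.
(* Each [x] lies in the [r]-neighbourhood of [deg r V x] vertices [v]. *)
have swap : \sum_(v in V) \sum_(x in V) r v x * deg e V x
    = \sum_(x in V) deg r V x * deg e V x.
  rewrite exchange_big; apply: eq_bigr => x _; rewrite /deg big_distrl /=.
  by apply: eq_bigr => y _; rewrite r_sym.
have tot : \sum_(v in V) pairs (mono e (r v)) V V
    + 2 * (\sum_(x in V) deg r V x * deg e V x) <= n * pairs e V V.
  rewrite -swap big_distrr -big_split -sum_nat_const; exact: leq_sum.
(* Every cut around a neighbourhood fails by at least 1, and [0 < #|V|] keeps the summed excess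
   positive, against [tot] and [good]. *)
have bad : n * (5 * n ^ 2).+1
    <= 8 * (n * pairs r V V + \sum_(v in V) pairs (mono e (r v)) V V).
  rewrite -!sum_nat_const -big_split big_distrr; apply: leq_sum => v vV.
  by rewrite ltnNge; apply: all_bad.
have good : 8 * (n * pairs e V V + n * pairs r V V)
    <= n * (5 * n ^ 2) + 16 * (\sum_(x in V) deg r V x * deg e V x).
  rewrite /pairs -[in leqRHS]sum_nat_const !big_distrr -!big_split big_distrr.
  apply: leq_sum => v vV /=.
  by apply: quarter_degrees_bound; [exact: aP | exact: deg_leq | exact: dP].
by move: tot bad good; rewrite mulnS /n; lia.
Qed.

Lemma cut_bound V :
  exists s, 8 * (pairs r V V + pairs (mono e s) V V) <= 5 * #|V| ^ 2.
Proof.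
have [k] := ubnP #|V|; elim: k V => // k IHk V; rewrite ltnS => leVk.
case: (posnP #|V|) => [/cards0_eq->|V0].
  by exists xpredT; rewrite /pairs !big_set0.
case: (boolP [exists v in V,
  16 * deg r V v + 8 * deg e V v + 5 <= 10 * #|V|]).
  case/exists_inP => v vV; have [|s sP] := IHk (V :\ v).
    by move: leVk; rewrite (cardsD1 v V) vV.
  exact: cut_bound_vertex sP.
rewrite negb_exists_in => /forall_inP vertexP.
case: (boolP [exists v in V, [exists w in V, r v w &&
  (16 * (deg r V v + deg r V w) + 8 * (deg e V v + deg e V w)
    <= 20 * #|V| + 12)]]).
  case/exists_inP => v vV /exists_inP[w wV /andP[rvw]].
  have [|s sP] := IHk (V :\: [set v; w]).
    apply: leq_trans leVk; apply: proper_card; apply/properP; split.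
      exact: subsetDl.
    by exists v => //; rewrite !inE eqxx.
  exact: cut_bound_edge sP.
rewrite negb_exists_in => /forall_inP edgeP.
(* Were [a_v = 0], [vertexP] would give [8 d_v >= 10n - 4], against [d_v < n]. *)
have nbr v : v \in V -> exists2 w, w \in V & r v w.
  move=> vV; have : 0 < deg r V v.
    by have := vertexP _ vV; have := deg_lt e_irr vV; lia.
  rewrite lt0n sum_nat_eq0 negb_forall_in => /exists_inP[w wV].
  by case rvw: (r v w) => // _; exists w.
(* Adding 8 times [a_v + d_w <= n] and 16 times [a_w + d_v <= n] to the failed edge test gives
   [8 a_v - 8 d_v >= 13 - 4n]. With [16 a_v + 8 d_v >= 10n - 4] from [vertexP], this yields
   [24 a_v >= 6n + 9]. *)
have rP v w : v \in V -> w \in V -> r v w -> #|V| <= 4 * deg r V v.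
  move=> vV wV rvw; have := edgeP _ vV; rewrite negb_exists_in.
  move/forall_inP/(_ _ wV); rewrite rvw /=.
  have := deg_add_leq V rvw; have := vertexP _ vV.
  have rwv : r w v by rewrite r_sym.
  by have := deg_add_leq V rwv; lia.
apply: cut_bound_average => // v vV; have [w wV rvw] := nbr v vV.
  exact: rP rvw.
have rwv : r w v by rewrite r_sym.
by have := rP _ _ wV vV rwv; have := deg_add_leq V rwv; lia.
Qed.

End CutBound.

(** * From ordered pairs back to edge sets and covering numbers *)

Section EdgeSets.
Local Open Scope nat_scope.
Variable T : finType.

Lemma mem_edges (f : rel T) x y : symmetric f -> irreflexive f ->
  ([set x; y] \in edges f) = f x y.
Proof.
move=> f_sym f_irr; apply/imsetP/idP => [[[u v]]|fxy]; last first.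
  by exists (x, y); rewrite ?inE.
rewrite inE /= => fuv xy.
have := set21 u v; have := set22 u v; rewrite -xy !inE.
by do 2![case/orP => /eqP ?]; subst; rewrite ?f_irr // f_sym in fuv *.
Qed.

(** Each edge in [X] has distinct ends, so it arises from two ordered pairs. *)
Lemma card_edge_set (f : rel T) (X : {set {set T}}) : irreflexive f ->
  X \subset edges f ->
  2 * #|X| <= pairs [rel x y | [set x; y] \in X] setT setT.
Proof.
move=> f_irr /subsetP Xf; rewrite /pairs /deg.
under [leqRHS]eq_bigl do rewrite inE.
under [leqRHS]eq_bigr do under eq_bigl do rewrite inE.
rewrite pair_big /=.
have memX (p : T * T) : ([set p.1; p.2] \in X : nat)
    = \sum_(B in X) ([set p.1; p.2] == B).
  case: (boolP (_ \in X)) => [pX|pX].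
    rewrite (bigD1 _ pX) /= eqxx big1 // => B /andP[_].
    by rewrite eq_sym => /negPf->.
  by rewrite big1 // => B BX; case: eqP pX => // ->; rewrite BX.
under [leqRHS]eq_bigr do rewrite memX.
rewrite exchange_big mulnC -sum_nat_const /=; apply: leq_sum => B /Xf.
case/imsetP => -[a b]; rewrite inE /= => fab ->.
have ab : (b, a) != (a, b).
  by apply: contraTneq fab => -[->]; rewrite f_irr.
by rewrite (bigD1 (a, b)) //= (bigD1 (b, a)) //= (setUC [set b]) eqxx.
Qed.

Variable e : rel T.
Hypotheses (e_sym : symmetric e) (e_irr : irreflexive e).

Lemma tauB_leq X : bipartite_edge_cover e X -> tauB e <= #|X|.
Proof.
move=> coverX; rewrite /tauB; case: arg_minnP => [|Y _]; last exact.
exact: bipartite_edge_cover_edges.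
Qed.

Lemma bipartite_triangle_free (f : rel T) : bipartite f -> triangle_free f.
Proof.
case/existsP => S /forallP SP; apply/forallP => x; apply/forallP => y.
apply/forallP => z; apply/negP => /and3P[xy yz xz].
have cut u v : f u v -> (u \in S) != (v \in S).
  by move/forallP: (SP u) => /(_ v) /implyP.
by move: (cut _ _ xy) (cut _ _ yz) (cut _ _ xz); do 3!case: (_ \in S).
Qed.

Lemma tau1_leq_tauB : tau1 e <= tauB e.
Proof.
rewrite /tauB; case: arg_minnP => [|X /andP[Xe biX] _].
  exact: bipartite_edge_cover_edges.
rewrite /tau1; case: arg_minnP => [|Y _ Ymin].
  exact: triangle_edge_cover_edges.
by apply: Ymin; rewrite /triangle_edge_cover Xe bipartite_triangle_free.
Qed.

(** Otherwise [x], [y], [z] form a triangle with two distinct edges in [A]. In this form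
    triangle-independence supplies the hypothesis [r_indep] of [cut_bound]. *)
Lemma triangle_independent_nbrs A x y z : triangle_independent e A ->
  [set x; y] \in A -> [set x; z] \in A -> ~~ e y z.
Proof.
case/andP => /subsetP Ae /forallP/(_ x)/forallP/(_ y)/forallP/(_ z).
move=> triA xyA xzA.
apply/negP => yz; move: triA; rewrite /triangle yz.
rewrite -!(mem_edges _ _ e_sym e_irr) !Ae //= leqNgt => /negP[].
have neq : [set x; y] != [set x; z].
  apply/eqP => /setP exyz; have := exyz y; have := exyz z.
  have yNz : y != z by apply: contraTneq yz => ->; rewrite e_irr.
  rewrite !inE !eqxx !orbT (negPf yNz) (eq_sym z y) (negPf yNz) !orbF.
  by move=> /eqP zx /esym/eqP yx; rewrite zx yx eqxx in yNz.
have <- : #|[set [set x; y]; [set x; z]]| = 2 by rewrite cards2 neq.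
apply/subset_leq_card/subsetP => B /set2P[]->; rewrite !inE ?xyA ?xzA ?eqxx //.
by rewrite orbT.
Qed.

(** Since [cut_bound] counts every edge twice, its factor 8 becomes 16; the edges missed by its cut
    form the bipartite cover. *)
Lemma alpha1_tauB_bound : 16 * (alpha1 e + tauB e) <= 5 * #|T| ^ 2.
Proof.
have [|A indA maxA] :=
    @eq_bigmax_cond _ (triangle_independent e) (fun A => #|A|).
  apply/card_gt0P; exists set0; rewrite unfold_in /triangle_independent sub0set.
  by do 3!apply/forallP => ?; rewrite set0I cards0 implybT.
have -> : alpha1 e = #|A| by exact: maxA.
have Ae : A \subset edges e by case/andP: indA.
pose r : rel T := [rel x y | [set x; y] \in A].
have r_sym : symmetric r by move=> x y; rewrite /r /= setUC.
have re : subrel r e.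
  by move=> x y; rewrite -(mem_edges _ _ e_sym e_irr); apply: (subsetP Ae).
have r_indep x y z : r x y -> r x z -> ~~ e y z.
  exact: triangle_independent_nbrs indA.
have [s] := cut_bound e_sym e_irr r_sym re r_indep setT.
have m_sym := mono_sym s e_sym.
have m_irr : irreflexive (mono e s) by move=> x; rewrite /mono /= e_irr.
have coverX : bipartite_edge_cover e (edges (mono e s)).
  apply/andP; split.
    apply/subsetP => B /imsetP[[x y]]; rewrite inE => /andP[/= exy _] ->.
    by rewrite mem_edges.
  apply/existsP; exists [set x | s x]; apply/forallP => x; apply/forallP => y.
  rewrite /del_edges /= mem_edges // /mono /= !inE.
  by apply/implyP => /andP[->].
have := tauB_leq coverX; have := card_edge_set e_irr Ae.
have := card_edge_set m_irr (subxx _).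
have -> : pairs [rel x y | [set x; y] \in edges (mono e s)] setT setT
    = pairs (mono e s) setT setT.
  by do 2!apply: eq_bigr => ? _; rewrite /= mem_edges.
rewrite -/r cardsT; lia.
Qed.

End EdgeSets.

Unset Implicit Arguments.

Theorem corollary2p4 (T : finType) (e : rel T) (n : nat)
    (e_sym : symmetric e) (e_irr : irreflexive e) (card_T : #|T| = n) :
  (alpha1 e + tau1 e <= alpha1 e + tauB e)%N /\
  ((alpha1 e + tauB e)%N%:R <= 5 * n%:R ^+ 2 / 16 :> rat).
Proof.
split; first by rewrite leq_add2l tau1_leq_tauB.
have := alpha1_tauB_bound e_sym e_irr; rewrite card_T => bound.
by rewrite ler_pdivlMr // mulrC -natrX -!natrM ler_nat.
Qed.
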